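(* The linear operators $D_+,D_0,D_-$ on the graph algebra $\mathcal A$, defined on the basis monomials $\boldsymbol{x}_S$, $S\subseteq[m]$, by $$D_+(\boldsymbol{x}_S)=\sum_{e\in[m]\setminus S}\boldsymbol{x}_{S\cup\{e\}},\qquad D_0(\boldsymbol{x}_S)=-(m-2|S|)\,\boldsymbol{x}_S,\qquad D_-(\boldsymbol{x}_S)=\sum_{e\in S}\boldsymbol{x}_{S\setminus\{e\}},$$ satisfy the relations $$[D_+,D_-]=D_0,\qquad [D_0,D_+]=2D_+,\qquad [D_0,D_-]=-2D_-,$$ and define on $\mathcal A$ the structure of an $\mathfrak{sl}_2$-module (with $e_+\mapsto D_+$, $e_-\mapsto D_-$, $h\mapsto D_0$).
   Context: Let $m=\binom n2$, where $n$ is the number of vertices, and $[m]=\{1,\dots,m\}$. The graph algebra is $\mathcal A=\mathbb C[x_1,\dots,x_m]/(x_1^2-x_1,\dots,x_m^2-x_m)$, with vector space basis the squarefree monomials $\boldsymbol{x}_S=\prod_{e\in S}x_e$, $S\subseteq[m]$. Empty sums are zero, so $D_+(\boldsymbol{x}_{[m]})=0$ and $D_-(\boldsymbol{x}_\varnothing)=0$. The Lie algebra $\mathfrak{sl}_2=\mathfrak{sl}_2(\mathbb C)$ has basis $e_+,e_-,h$ with $[h,e_+]=2e_+$, $[h,e_-]=-2e_-$, $[e_+,e_-]=h$. Brackets of operators are commutators $[X,Y]=XY-YX$. *)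

(* Defs.v *)
From HB Require Import structures.
From mathcomp Require Import all_boot all_order all_algebra.
From mathcomp Require Import ring_quotient complex.
From mathcomp Require Import boolp reals.
From mathcomp Require Import mpoly ring.

Set Implicit Arguments.
Unset Strict Implicit.
Unset Printing Implicit Defensive.

Import GRing.Theory.

Local Open Scope ring_scope.
Local Open Scope quotient_scope.

Definition commutator (K : pzRingType) (V : lmodType K) (X Y : V -> V) : V -> V :=
  (X \o Y) \- (Y \o X).

Section BooleanIdeal.
Variables (K : fieldType) (m : nat).

(* The ideal generated by the x_i^2 - x_i; membership is decided classically. *)
Definition boolean_ideal : {pred {mpoly K[m]}} := fun p =>
  `[< exists g : 'I_m -> {mpoly K[m]}, p = \sum_i g i * ('X_i ^+ 2 - 'X_i) >].

Lemma boolean_idealP p : reflect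
  (exists g : 'I_m -> {mpoly K[m]}, p = \sum_i g i * ('X_i ^+ 2 - 'X_i))
  (p \in boolean_ideal).
Proof. exact: asboolP. Qed.

Lemma boolean_ideal_closed : idealr_closed boolean_ideal.
Proof.
split.
- by apply/boolean_idealP; exists (fun=> 0); rewrite big1 // => i _; rewrite mul0r.
- apply/boolean_idealP => -[g /(congr1 (meval (fun=> 0)))].
  rewrite meval1 raddf_sum /= big1; first by move/eqP; rewrite oner_eq0.
  by move=> i _; rewrite rmorphM rmorphB rmorphXn /= mevalXU expr0n subrr mulr0.
- move=> a p q /boolean_idealP[g ->] /boolean_idealP[g' ->].
  apply/boolean_idealP; exists (fun i => a * g i + g' i).
  rewrite mulr_sumr -big_split; apply: eq_bigr => i _.
  by rewrite mulrDl mulrA.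
Qed.

HB.instance Definition _ := isIdealr.Build _ boolean_ideal boolean_ideal_closed.

End BooleanIdeal.

Arguments boolean_ideal : clear implicits.

Definition graph_algebra (K : fieldType) (m : nat) : Type :=
  {ideal_quot (boolean_ideal K m)}.

Section GraphAlgebra.
Variables (K : fieldType) (m : nat).
Local Notation A := (graph_algebra K m).

Implicit Types (p q : {mpoly K[m]}) (k : 'X_{1..m}) (S : {set 'I_m}).

HB.instance Definition _ := GRing.ComNzRing.on A.

Definition graph_pi : {mpoly K[m]} -> A := \pi_({ideal_quot (boolean_ideal K m)}).

Lemma graph_pi_is_zmod_morphism : zmod_morphism graph_pi.
Proof. exact: raddfB. Qed.
HB.instance Definition _ :=
  GRing.isZmodMorphism.Build _ _ graph_pi graph_pi_is_zmod_morphism.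

Lemma graph_pi_is_monoid_morphism : monoid_morphism graph_pi.
Proof. by split; [exact: rmorph1 | exact: rmorphM]. Qed.
HB.instance Definition _ :=
  GRing.isMonoidMorphism.Build _ _ graph_pi graph_pi_is_monoid_morphism.

Definition graph_repr : A -> {mpoly K[m]} :=
  @repr _ {ideal_quot (boolean_ideal K m)}.

Lemma graph_reprK : cancel graph_repr graph_pi.
Proof. exact: reprK. Qed.

Lemma graph_pi_eq p q : graph_pi p = graph_pi q <-> p - q \in boolean_ideal K m.
Proof.
have E := Quotient.idealrBE (boolean_ideal K m) p q.
by split=> [|] H; [rewrite E; apply/eqP | apply/eqP; rewrite -E].
Qed.

Definition graph_scale (c : K) (a : A) : A := graph_pi c%:MP * a.

Fact graph_scaleA b c a : graph_scale b (graph_scale c a) = graph_scale (b * c) a.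
Proof. by rewrite /graph_scale mulrA -rmorphM /= mpolyCM. Qed.
Fact graph_scale1 : left_id 1 graph_scale.
Proof. by move=> a; rewrite /graph_scale rmorph1 mul1r. Qed.
Fact graph_scaleDr : right_distributive graph_scale +%R.
Proof. by move=> c a b; rewrite /graph_scale mulrDr. Qed.
Fact graph_scaleDl a : {morph graph_scale^~ a : b c / b + c}.
Proof. by move=> b c; rewrite /graph_scale mpolyCD rmorphD mulrDl. Qed.

HB.instance Definition _ := GRing.Zmodule_isLmodule.Build K A
  graph_scaleA graph_scale1 graph_scaleDr graph_scaleDl.

Fact graph_scaleAl (c : K) (a b : A) : c *: (a * b) = (c *: a) * b.
Proof. exact: mulrA. Qed.
HB.instance Definition _ := GRing.Lmodule_isLalgebra.Build K A graph_scaleAl.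
Fact graph_scaleAr (c : K) (a b : A) : c *: (a * b) = a * (c *: b).
Proof. by rewrite mulrC graph_scaleAl mulrC. Qed.
HB.instance Definition _ := GRing.Lalgebra_isAlgebra.Build K A graph_scaleAr.

Lemma graph_pi_is_scalable : scalable graph_pi.
Proof.
by move=> c p; rewrite -mul_mpolyC rmorphM.
Qed.
HB.instance Definition _ :=
  GRing.isScalable.Build _ _ _ _ graph_pi graph_pi_is_scalable.

Definition xvar (e : 'I_m) : A := graph_pi 'X_e.

Definition xmon S : A := \prod_(e in S) xvar e.

Lemma xvarXX e : xvar e ^+ 2 = xvar e.
Proof.
rewrite -rmorphXn; apply/graph_pi_eq/boolean_idealP.
exists (fun i => (i == e)%:R); rewrite (bigD1 e) //= eqxx mul1r big1 ?addr0 //.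
by move=> i /negPf ->; rewrite mul0r.
Qed.

Definition mnm_supp k : {set 'I_m} := [set i | k i != 0%N].

Lemma graph_piX k : graph_pi 'X_[k] = xmon (mnm_supp k).
Proof.
rewrite mpolyXE_id rmorph_prod /xmon [RHS]big_mkcond /=; apply: eq_bigr => i _.
rewrite rmorphXn inE; case: (k i) => [|j] //=.
elim: j => [|j IH]; first by rewrite expr1.
by rewrite exprS IH -expr2 xvarXX.
Qed.

(* Linear extension along the basis (xmon S), computed on a representative:
   the monomial 'X_[k] is congruent to the squarefree one on its support.
   Lemma linext_piE shows independence of the representative. *)
Section LinearExtension.
Variables (W : lmodType K) (f : {set 'I_m} -> W).

Definition mpoly_ext p : W := \sum_(k <- msupp p) p@_k *: f (mnm_supp k).

Definition linext (a : A) : W := mpoly_ext (graph_repr a).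

Lemma mpoly_extE p (s : seq 'X_{1..m}) : uniq s -> {subset msupp p <= s} ->
  mpoly_ext p = \sum_(k <- s) p@_k *: f (mnm_supp k).
Proof.
move=> us sub; rewrite [RHS](bigID (fun k => k \in msupp p)) /=.
rewrite [X in _ + X]big1 ?addr0; last first.
  by move=> k /memN_msupp_eq0 ->; rewrite scale0r.
rewrite -big_filter; apply: perm_big; apply: uniq_perm => //.
  by rewrite filter_uniq.
by move=> k; rewrite mem_filter andb_idr // => /sub.
Qed.

Lemma mpoly_ext_is_linear : linear mpoly_ext.
Proof.
move=> c p q; pose s := undup (msupp (c *: p + q) ++ msupp p ++ msupp q).
have us : uniq s by apply: undup_uniq.
rewrite !(@mpoly_extE _ s) ?us //;
  try by move=> k kp; rewrite mem_undup !mem_cat kp ?orbT.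
rewrite scaler_sumr -big_split; apply: eq_bigr => k _ /=.
by rewrite mcoeffD mcoeffZ scalerDl scalerA.
Qed.
HB.instance Definition _ :=
  GRing.isLinear.Build K _ _ _ mpoly_ext mpoly_ext_is_linear.

Lemma mpoly_extX k : mpoly_ext 'X_[k] = f (mnm_supp k).
Proof. by rewrite /mpoly_ext msuppX big_seq1 mcoeffX eqxx scale1r. Qed.

Lemma mpoly_ext_ideal p : p \in boolean_ideal K m -> mpoly_ext p = 0.
Proof.
move=> /boolean_idealP[g ->]; rewrite raddf_sum big1 // => i _ /=.
rewrite {1}(mpolyE (g i)) mulr_suml raddf_sum big1 // => k _ /=.
rewrite -scalerAl linearZ /= mulrBr raddfB /= expr2 mulrA -!mpolyXD !mpoly_extX.
rewrite [X in X - _](_ : _ = f (mnm_supp (k + U_(i))%MM)) ?subrr ?scaler0 //.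
congr f; apply/setP => j; rewrite !inE !mnmDE mnm1E.
by case: (i == j); rewrite ?addn0 // !addn1.
Qed.

Lemma linext_piE p : linext (graph_pi p) = mpoly_ext p.
Proof.
apply/eqP; rewrite -subr_eq0 -raddfB; apply/eqP/mpoly_ext_ideal.
by apply/graph_pi_eq; rewrite graph_reprK.
Qed.

Lemma linext_is_linear : linear linext.
Proof.
move=> c a b; rewrite -[a]graph_reprK -[b]graph_reprK -linearP !linext_piE.
exact: linearP.
Qed.
HB.instance Definition _ := GRing.isLinear.Build K _ _ _ linext linext_is_linear.

Lemma linext_xmon S : linext (xmon S) = f S.
Proof.
pose k : 'X_{1..m} := [multinom (i \in S : nat) | i < m].
have kS : mnm_supp k = S by apply/setP => i; rewrite inE mnmE eqb0 negbK.
by rewrite -{1}kS -graph_piX linext_piE mpoly_extX kS.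
Qed.

End LinearExtension.

Lemma linear_xmon_ext (W : lmodType K) (f g : {linear A -> W}) :
  (forall S, f (xmon S) = g (xmon S)) -> f =1 g.
Proof.
move=> fg a; rewrite -[a]graph_reprK (mpolyE (graph_repr a)) !raddf_sum.
by apply: eq_bigr => k _ /=; rewrite !linearZ /= graph_piX fg.
Qed.

Lemma xmon_basis (a : A) :
  exists! c : {ffun {set 'I_m} -> K}, a = \sum_S c S *: xmon S.
Proof.
pose d S : A -> K^o := linext (fun T => (T == S)%:R : K^o).
have dE c S : d S (\sum_T c T *: xmon T) = c S.
  rewrite /d raddf_sum (bigD1 S) //= big1 => [|T /negPf TS].
    by rewrite linearZ /= linext_xmon eqxx addr0 [LHS]mulr1.
  by rewrite linearZ /= linext_xmon TS scaler0.
have spanE : exists c : {set 'I_m} -> K, a = \sum_S c S *: xmon S.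
  rewrite -[a]graph_reprK (mpolyE (graph_repr a)) raddf_sum /=.
  elim: (msupp _) => [|k s [c IH]].
    by exists (fun=> 0); rewrite big_nil big1 // => S _; rewrite scale0r.
  exists (fun S => (graph_repr a)@_k * (S == mnm_supp k)%:R + c S).
  rewrite big_cons IH linearZ /= graph_piX.
  under [RHS]eq_bigr do rewrite scalerDl.
  rewrite big_split /=; congr (_ + _).
  rewrite (bigD1 (mnm_supp k)) //= eqxx mulr1 big1 ?addr0 // => S /negPf ->.
  by rewrite mulr0 scale0r.
have [c aE] := spanE; exists (finfun c); split=> [|c' aE'].
  by rewrite aE; apply: eq_bigr => S _; rewrite ffunE.
by apply/ffunP => S; rewrite ffunE -(dE c) -(dE c') -aE -aE'.
Qed.

Definition Dplus : A -> A := linext (fun S => \sum_(e in ~: S) xmon (e |: S)).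

Definition Dzero : A -> A :=
  linext (fun S => - (m%:R - 2 * #|S|%:R) *: xmon S).

Definition Dminus : A -> A := linext (fun S => \sum_(e in S) xmon (S :\ e)).

HB.instance Definition _ := GRing.Linear.on Dplus.
HB.instance Definition _ := GRing.Linear.on Dzero.
HB.instance Definition _ := GRing.Linear.on Dminus.

Lemma Dplus_xmon S : Dplus (xmon S) = \sum_(e in ~: S) xmon (e |: S).
Proof. exact: linext_xmon. Qed.

Lemma Dzero_xmon S : Dzero (xmon S) = - (m%:R - 2 * #|S|%:R) *: xmon S.
Proof. exact: linext_xmon. Qed.

Lemma Dminus_xmon S : Dminus (xmon S) = \sum_(e in S) xmon (S :\ e).
Proof. exact: linext_xmon. Qed.

End GraphAlgebra.

Definition is_lie_bracket (K : fieldType) (g : lmodType K) (br : g -> g -> g) :=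
  [/\ forall x, linear (br x), forall y, linear (br^~ y), forall x, br x x = 0
    & forall x y z, br x (br y z) + br y (br z x) + br z (br x y) = 0].

Definition is_lie_module (K : fieldType) (g : lmodType K) (br : g -> g -> g)
    (V : lmodType K) (act : g -> V -> V) :=
  [/\ forall x, linear (act x), forall v, linear (act^~ v)
    & forall x y, act (br x y) =1 commutator (act x) (act y)].

Section SL2.
Variable K : fieldType.

Definition traceless : {pred 'M[K]_2} := fun M => \tr M == 0.

Lemma traceless_submod_closed : submod_closed traceless.
Proof.
split=> [|c M N /eqP M0 /eqP N0]; first by rewrite unfold_in mxtrace0.
by rewrite unfold_in mxtraceD mxtraceZ M0 N0 mulr0 addr0.
Qed.
HB.instance Definition _ :=
  GRing.isSubmodClosed.Build _ _ traceless traceless_submod_closed.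

Record sl2 := Sl2 { sl2_mx :> 'M[K]_2; sl2_mxP : sl2_mx \in traceless }.

HB.instance Definition _ := [isSub for sl2_mx].
HB.instance Definition _ := [Choice of sl2 by <:].
HB.instance Definition _ := [SubChoice_isSubLmodule of sl2 by <:].

Implicit Types X Y : sl2.

Fact sl2_bracket_subproof X Y : sl2_mx X *m Y - sl2_mx Y *m X \in traceless.
Proof. by rewrite unfold_in raddfB /= mxtrace_mulC subrr. Qed.

Definition sl2_bracket X Y : sl2 := Sl2 (sl2_bracket_subproof X Y).

Fact sl2_eplus_subproof : delta_mx 0 1 \in traceless.
Proof. by rewrite unfold_in /mxtrace big_ord_recl big_ord1 !mxE addr0. Qed.
Fact sl2_eminus_subproof : delta_mx 1 0 \in traceless.
Proof. by rewrite unfold_in /mxtrace big_ord_recl big_ord1 !mxE addr0. Qed.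
Fact sl2_h_subproof : delta_mx 0 0 - delta_mx 1 1 \in traceless.
Proof.
by rewrite unfold_in /mxtrace big_ord_recl big_ord1 !mxE /= subr0 add0r subrr.
Qed.

Definition sl2_eplus := Sl2 sl2_eplus_subproof.
Definition sl2_eminus := Sl2 sl2_eminus_subproof.
Definition sl2_h := Sl2 sl2_h_subproof.

Lemma sl2_lie : is_lie_bracket sl2_bracket.
Proof.
split.
- move=> X c Y Z; apply: val_inj => /=.
  by rewrite mulmxDl mulmxDr -scalemxAl -scalemxAr scalerBr opprD addrACA.
- move=> X c Y Z; apply: val_inj => /=.
  by rewrite mulmxDl mulmxDr -scalemxAl -scalemxAr scalerBr opprD addrACA.
- by move=> X; apply: val_inj; rewrite /= subrr.
- move=> X Y Z; apply: val_inj => /=.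
  rewrite !mulmxBl !mulmxBr !mulmxA.
  move: (X *m Y *m Z) (Y *m Z *m X) (Z *m X *m Y) => a b c.
  move: (X *m Z *m Y) (Y *m X *m Z) (Z *m Y *m X) => d e f.
  by apply/matrixP => i j; rewrite !mxE; ring.
Qed.

Lemma sl2_ep_em : sl2_bracket sl2_eplus sl2_eminus = sl2_h.
Proof. by apply: val_inj; rewrite /= !mul_delta_mx. Qed.

Lemma sl2_h_ep : sl2_bracket sl2_h sl2_eplus = 2 *: sl2_eplus.
Proof.
apply: val_inj; rewrite /= mulmxBl mulmxBr !mul_delta_mx_cond /=.
by rewrite ?mulr0n ?mulr1n subr0 sub0r opprK scaler_nat mulr2n.
Qed.

Lemma sl2_h_em : sl2_bracket sl2_h sl2_eminus = - 2 *: sl2_eminus.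
Proof.
apply: val_inj; rewrite /= mulmxBl mulmxBr !mul_delta_mx_cond /=.
by rewrite ?mulr0n ?mulr1n subr0 sub0r scaleNr scaler_nat mulr2n opprD.
Qed.

Lemma sl2_basis X : exists! c : K * K * K,
  X = c.1.1 *: sl2_eplus + c.1.2 *: sl2_eminus + c.2 *: sl2_h.
Proof.
have X11 : X 1 1 = - X 0 0.
  have /eqP := sl2_mxP X; rewrite /mxtrace big_ord_recl big_ord1 => /eqP.
  by rewrite addrC addr_eq0 (_ : lift 0 0 = 1) => [/eqP|]; last exact: val_inj.
have entries (M : 'M[K]_2) : M = M 0 1 *: delta_mx 0 1 + M 1 0 *: delta_mx 1 0
    + (M 0 0 *: delta_mx 0 0 + M 1 1 *: delta_mx 1 1).
  rewrite {1}[M]matrix_sum_delta !big_ord_recl !big_ord0 /= !addr0.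
  rewrite (_ : lift 0 0 = 1); last exact: val_inj.
  rewrite (_ : ord0 = 0); last exact: val_inj.
  move: (_ *: delta_mx 0 0) (_ *: delta_mx 0 1) (_ *: delta_mx 1 0) => p q r.
  by rewrite [p + q]addrC addrACA.
exists (X 0 1, X 1 0, X 0 0); split=> /= [|[[a b] c] /= ->].
  by apply: val_inj; rewrite /= {1}(entries X) X11 scalerBr scaleNr.
by rewrite !mxE /= !(oppr0, mulr0, mulr1, addr0, add0r, subr0).
Qed.

End SL2.

(* Main.v *)
From HB Require Import structures.
Require Import Defs.
From mathcomp Require Import all_boot all_order all_algebra.
From mathcomp Require Import complex reals.
From mathcomp Require Import boolp ring.

(** The space A has a basis indexed by the subsets S of [m]; D_+ adds an
    element to S in all ways and D_- removes one in all ways. In D_+ D_- and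
    D_- D_+ applied to x_S, the terms that exchange some f in S for some e
    outside S are the same on both sides and cancel; what remains are the ways
    to come back to S, of which there are |S| in D_+ D_- (remove an element, put
    it back) and m - |S| in D_- D_+. Hence [D_+, D_-] multiplies x_S by
    |S| - (m - |S|), which is the eigenvalue of D_0
    (commutator_Dplus_Dminus). The other two relations say that D_+ and D_-
    change this eigenvalue by 2 and -2.

    The module structure is a formal consequence. A matrix X of sl_2 is
    X_01 e_+ + X_10 e_- + X_00 h, so an action with prescribed values on the
    basis must be the operator sl2_act (sl2_module_eq), and conversely,
    commutators being bilinear and alternating, the three relations determine
    all commutators of such operators and make sl2_act compatible with brackets
    (sl2_act_is_lie_module). *)

Import GRing.Theory.
Local Open Scope ring_scope.

Section BooleanLattice.
Variables (K : fieldType) (m : nat).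
Implicit Types (e f : 'I_m) (S : {set 'I_m}).

Local Notation xmon := (@xmon K m).
Local Notation Dplus := (@Dplus K m).
Local Notation Dminus := (@Dminus K m).
Local Notation Dzero := (@Dzero K m).

(** The sum over the elements that can be added to S minus e is split into
    e itself, which restores S, and the elements outside S: the latter give the
    exchange terms, indexed exactly as those of Dminus_setU1. *)
Lemma Dplus_setD1 e S : e \in S ->
  Dplus (xmon (S :\ e)) = xmon S + \sum_(f in ~: S) xmon (f |: (S :\ e)).
Proof.
move=> eS; rewrite Dplus_xmon (bigD1 e) /=; last by rewrite !inE eqxx.
rewrite setD1K //; congr (_ + _); apply: eq_bigl => f; rewrite !inE.
by case: eqVneq => [->|_]; rewrite ?eS ?andbT.
Qed.

Lemma Dminus_setU1 e S : e \notin S ->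
  Dminus (xmon (e |: S)) = xmon S + \sum_(f in S) xmon (e |: (S :\ f)).
Proof.
move=> eS; rewrite Dminus_xmon big_setU1 //= setU1K //; congr (_ + _).
apply: eq_bigr => f fS; congr (xmon _); apply/setP => g; rewrite !inE.
by case: (eqVneq g e) => [->|] //=; case: eqVneq fS eS => // -> ->.
Qed.

Lemma commutator_Dplus_Dminus : commutator Dplus Dminus =1 Dzero.
Proof.
apply: (@linear_xmon_ext _ _ _ ((Dplus \o Dminus) \- (Dminus \o Dplus))) => S /=.
rewrite Dminus_xmon Dplus_xmon (raddf_sum Dplus) (raddf_sum Dminus) /=.
under eq_bigr => e eS do rewrite Dplus_setD1 //.
under [X in _ - X]eq_bigr => e eS do rewrite Dminus_setU1 -?in_setC //.
(* Swapping the order of summation on one side makes the exchange terms of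
   both sides equal, so that they cancel. *)
rewrite !big_split /= [X in _ + X - _]exchange_big /=.
rewrite opprD addrACA subrr addr0 Dzero_xmon.
rewrite !sumr_const -!scaler_nat -scalerBl; congr (_ *: _).
have /(congr1 (fun k => k%:R : K)) := cardsC S.
rewrite card_ord natrD => <-; ring.
Qed.

Lemma commutator_Dzero_Dplus : commutator Dzero Dplus =1 2 \*: Dplus.
Proof.
apply: (@linear_xmon_ext _ _ _ ((Dzero \o Dplus) \- (Dplus \o Dzero))
          (2 \*: Dplus)) => S /=.
rewrite Dzero_xmon linearZ /= Dplus_xmon raddf_sum !scaler_sumr -sumrB.
apply: eq_bigr => e; rewrite inE => eS /=.
rewrite Dzero_xmon -scalerBl cardsU1 eS; congr (_ *: _).
rewrite natrD /=; ring.
Qed.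

Lemma commutator_Dzero_Dminus : commutator Dzero Dminus =1 (- 2) \*: Dminus.
Proof.
apply: (@linear_xmon_ext _ _ _ ((Dzero \o Dminus) \- (Dminus \o Dzero))
          ((- 2) \*: Dminus)) => S /=.
rewrite Dzero_xmon linearZ /= Dminus_xmon raddf_sum !scaler_sumr -sumrB.
apply: eq_bigr => e eS /=.
rewrite Dzero_xmon -scalerBl (cardsD1 e S) eS; congr (_ *: _).
rewrite natrD /=; ring.
Qed.

End BooleanLattice.

Section Commutator.
Variables (K : fieldType) (V : lmodType K).
Implicit Types (f g h : {linear V -> V}) (a : K).

Lemma commutatorDl f g h v :
  commutator (f \+ g) h v = commutator f h v + commutator g h v.
Proof. by rewrite /commutator /= linearD /= opprD addrACA. Qed.

Lemma commutatorDr f g h v :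
  commutator f (g \+ h) v = commutator f g v + commutator f h v.
Proof. by rewrite /commutator /= linearD /= opprD addrACA. Qed.

Lemma commutatorZl a f g v :
  commutator (a \*: f) g v = a *: commutator f g v.
Proof. by rewrite /commutator /= linearZ /= scalerBr. Qed.

Lemma commutatorZr a f g v :
  commutator f (a \*: g) v = a *: commutator f g v.
Proof. by rewrite /commutator /= linearZ /= scalerBr. Qed.

Lemma commutator_id f v : commutator f f v = 0.
Proof. exact: subrr. Qed.

Lemma commutatorC f g v : commutator f g v = - commutator g f v.
Proof. by rewrite /commutator /= opprB. Qed.

End Commutator.

Section SL2Modules.
Variables (K : fieldType) (V : lmodType K).

(** The scalars are the coordinates of X in the basis e_+, e_-, h. Pointwise
    operations on functions are used so that the linear structure of the
    operator is inferred. *)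
Definition sl2_act (E F H : {linear V -> V}) (X : sl2 K) : V -> V :=
  (sl2_mx X 0 1 \*: E) \+ (sl2_mx X 1 0 \*: F) \+ (sl2_mx X 0 0 \*: H).

Lemma sl2_mx11 (X : sl2 K) : sl2_mx X 1 1 = - sl2_mx X 0 0.
Proof.
have := sl2_mxP X; rewrite unfold_in /mxtrace big_ord_recl big_ord1.
by rewrite addrC addr_eq0 (_ : lift 0 0 = 1) => [/eqP|]; last exact: val_inj.
Qed.

(** Compatibility with brackets is checked by expanding the commutator of two
    combinations of E, F, H bilinearly: the diagonal terms vanish, and each
    remaining commutator is a multiple of a single operator among E, F, H, so it
    is enough to compare the three coefficients with the entries of
    X Y - Y X. *)
Lemma sl2_act_is_lie_module (E F H : {linear V -> V}) :
    commutator E F =1 H -> commutator H E =1 2 \*: E ->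
    commutator H F =1 (- 2) \*: F ->
  is_lie_module (@sl2_bracket K) (sl2_act E F H).
Proof.
move=> EF HE HF; split=> [X|v c X Y|X Y v].
- exact: linearP.
- rewrite /sl2_act /= !mxE !scalerDl !scalerDr !scalerA.
  by rewrite [in LHS](AC ((2*2)*2) ((1*3*5)*(2*4*6))).
rewrite /sl2_act !(commutatorDl, commutatorDr, commutatorZl, commutatorZr).
rewrite !commutator_id (commutatorC _ _ F E) (commutatorC _ _ E H).
rewrite (commutatorC _ _ F H).
rewrite EF HE HF /= !scaler0 !(add0r, addr0).
(* The six terms come in the order EF, EH, FE, FH, HE, HF and are grouped by
   the operator they are multiples of. *)
rewrite [RHS](AC ((2*2)*2) ((2*5)*(4*6)*(1*3))) /=.
rewrite !scalerN -!scaleNr !scalerA -!scalerDl.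
rewrite !mxE !big_ord_recl !big_ord0 /= !addr0.
rewrite (_ : lift ord0 ord0 = 1); last exact: val_inj.
(* Tracelessness is what turns the (0, 1) and (1, 0) entries of X Y - Y X into
   twice a minor. *)
rewrite !sl2_mx11; congr (_ *: _ + _ *: _ + _ *: _); ring.
Qed.

Lemma sl2_act_basis (E F H : {linear V -> V}) :
  [/\ sl2_act E F H (sl2_eplus K) = E,
      sl2_act E F H (sl2_eminus K) = F
    & sl2_act E F H (sl2_h K) = H].
Proof.
by split; apply/funext => v; rewrite /sl2_act /= !mxE /=
  ?(subr0, scale0r, scale1r, addr0, add0r).
Qed.

Lemma sl2_module_eq (act act' : sl2 K -> V -> V) :
    is_lie_module (@sl2_bracket K) act -> is_lie_module (@sl2_bracket K) act' ->
    act (sl2_eplus K) = act' (sl2_eplus K) ->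
    act (sl2_eminus K) = act' (sl2_eminus K) ->
    act (sl2_h K) = act' (sl2_h K) ->
  act = act'.
Proof.
move=> actP act'P Ep Em Eh; apply/funext => X; apply/funext => v.
have act_basis (rho : sl2 K -> V -> V) a b c :
    is_lie_module (@sl2_bracket K) rho ->
    rho (a *: sl2_eplus K + b *: sl2_eminus K + c *: sl2_h K) v
    = a *: rho (sl2_eplus K) v + b *: rho (sl2_eminus K) v
      + c *: rho (sl2_h K) v.
  case=> _ /(_ v) lin _.
  pose L := GRing.isLinear.Build K (sl2 K) V _ _ lin.
  pose r : {linear sl2 K -> V} := HB.pack (rho^~ v) L.
  by rewrite -[LHS]/(r _) !linearD !linearZ.
by have [[[a b] c] [/= -> _]] := sl2_basis X; rewrite !act_basis // Ep Em Eh.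
Qed.

End SL2Modules.

Theorem theorem3p1 (R : realType) (n : nat) :
  let A := graph_algebra R[i] 'C(n, 2) in
  let Dp : A -> A := @Dplus R[i] 'C(n, 2) in
  let D0 : A -> A := @Dzero R[i] 'C(n, 2) in
  let Dm : A -> A := @Dminus R[i] 'C(n, 2) in
  [/\ commutator Dp Dm =1 D0,
      commutator D0 Dp =1 2 \*: Dp,
      commutator D0 Dm =1 (- 2) \*: Dm
    & exists! act : sl2 R[i] -> A -> A,
        [/\ is_lie_module (@sl2_bracket R[i]) act,
            act (@sl2_eplus R[i]) = Dp,
            act (@sl2_eminus R[i]) = Dm
          & act (@sl2_h R[i]) = D0]].
Proof.
have relEF := @commutator_Dplus_Dminus R[i] 'C(n, 2).
have relHE := @commutator_Dzero_Dplus R[i] 'C(n, 2).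
have relHF := @commutator_Dzero_Dminus R[i] 'C(n, 2).
move=> A Dp D0 Dm; split=> //.
have actP := sl2_act_is_lie_module _ _ _ _ _ relEF relHE relHF.
have [actE actF actH] := sl2_act_basis _ _ (@Dplus R[i] 'C(n, 2))
  (@Dminus R[i] 'C(n, 2)) (@Dzero R[i] 'C(n, 2)).
exists (sl2_act _ _ (@Dplus R[i] 'C(n, 2)) (@Dminus R[i] 'C(n, 2))
  (@Dzero R[i] 'C(n, 2))).
split=> [|act [act'P actE' actF' actH']]; first by split.
by apply: sl2_module_eq; rewrite ?actE ?actF ?actH.
Qed.
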